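(* Let $\{n_i\}_{i\ge 1}$ and $\{m_j\}_{j\ge 1}$ be any sequences of integers greater than $2$. Then the following statements are equivalent: (1) There exists some $i \ge 1$ such that $$\frac{\log n_i}{\log m_j} \in \mathbb{R} \setminus \mathbb{Q} \quad \text{for all } j \ge 1;$$ (2) $$\bigcup_{i \ge 1} \mathcal{D}_{n_i} \not\subseteq \bigcup_{j \ge 1} \mathcal{D}_{m_j}.$$
   Context: For an integer $n\ge 2$, an $n$-adic interval is an interval of the form $I=\left[\frac{k-1}{n^\ell},\frac{k}{n^\ell}\right)$ with $\ell,k\in\mathbb{Z}$. Its $n$-adic children are the $n$ intervals $I_j=\left[\frac{k-1}{n^\ell}+\frac{j-1}{n^{\ell+1}},\frac{k-1}{n^\ell}+\frac{j}{n^{\ell+1}}\right)$, $1\le j\le n$. A (nonnegative Borel) measure $\mu$ on $\mathbb{R}$ is an $n$-adic doubling measure if there is a constant $C>0$ such that for every $n$-adic interval $I$ and all $1\le j_1,j_2\le n$, $\frac1C\le \frac{\mu(I_{j_1})}{\mu(I_{j_2})}\le C$ (in particular these ratios are well defined, i.e. $n$-adic intervals have positive finite measure). $\mathcal{D}_n$ denotes the collection of all $n$-adic doubling measures on $\mathbb{R}$. *)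

(* Defs.v *)
From mathcomp Require Import all_boot all_order all_algebra.
From mathcomp Require Import all_classical all_reals all_analysis.

Import Order.TTheory GRing.Theory Num.Theory.

Local Open Scope classical_set_scope.
Local Open Scope ring_scope.

(* The exponent [l : int] may be negative, so arbitrarily long intervals are
   included. *)
Definition adic_interval (R : realType) (n : nat) (l k : int) : set R :=
  `[(k - 1)%:~R / n%:R ^ l, k%:~R / n%:R ^ l[.

(* [j] ranges over 1, ..., n. *)
Definition adic_child (R : realType) (n : nat) (l k : int) (j : nat) : set R :=
  `[(k - 1)%:~R / n%:R ^ l + (j%:R - 1) / n%:R ^ (l + 1),
    (k - 1)%:~R / n%:R ^ l + j%:R / n%:R ^ (l + 1)[.

(* [measurableTypeR R] carries the Borel sigma-algebra ([RGenOpens.measurableE]).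
   The first conjunct says that the ratios below are well defined; since the
   masses are then finite, taking them through [fine] loses nothing. *)
Definition adic_doubling (R : realType) (n : nat) :
    set {measure set (measurableTypeR R) -> \bar R} :=
  [set mu : {measure set (measurableTypeR R) -> \bar R} |
    (forall l k : int, (0 < mu (adic_interval R n l k) < +oo)%E) /\
    exists C : R, 0 < C /\
      forall (l k : int) (j1 j2 : nat),
        (1 <= j1 <= n)%N -> (1 <= j2 <= n)%N ->
        C^-1 <= fine (mu (adic_child R n l k j1))
                / fine (mu (adic_child R n l k j2)) <= C].

(* Main.v *)
From HB Require Import structures.
Require Import Defs.
From mathcomp Require Import all_boot all_order all_algebra.
From mathcomp Require Import all_classical all_reals all_analysis.
From mathcomp Require Import ring lra zify.
Import Order.TTheory GRing.Theory Num.Theory.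
Import numFieldNormedType.Exports.
Local Open Scope classical_set_scope.
Local Open Scope ring_scope.

(* If n^a = m^b with a, b > 0, then D_n = D_(n^a) = D_(m^b) = D_m, because every
   n-adic interval lies between an n^a-adic interval and one of its children.
   Otherwise write n^l = m^j q with m not dividing q; the cofactors q are
   unbounded in l, since two equal ones would give a relation n^a = m^b.
   Let F be the identity except on the intervals [n^L, 2 n^L], where
   F x = n^L + (x - n^L)^2 / n^L, and let mu [a, b[ = F b - F a. This measure is
   n-adic doubling: an n-adic interval either sits inside some [n^L, 2 n^L] or
   has all endpoints of its children fixed by F. But the intervals of length m^j
   on both sides of n^l are children of one m-adic interval (m does not divide
   q), and the mass on the left is at least q times the mass on the right. *)

(** * Nesting of adic intervals *)

(* Zero-based: [cell R n l k] is [adic_interval R n l (k + 1)]. *)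
Definition cell (R : realType) (n : nat) (l k : int) : set R :=
  `[k%:~R / n%:R ^ l, (k + 1)%:~R / n%:R ^ l[.

Lemma adic_intervalE (R : realType) n l k :
  adic_interval R n l k = cell R n l (k - 1).
Proof. by rewrite /adic_interval /cell subrK. Qed.

Lemma adic_childE (R : realType) n l k j : (0 < n)%N ->
  adic_child R n l k j.+1 = cell R n (l + 1) ((k - 1) * n%:Z + j%:Z).
Proof.
move=> n_gt0; have n0 : n%:R != 0 :> R by rewrite pnatr_eq0 -lt0n.
have nl0 : n%:R ^ l != 0 :> R by rewrite expfz_neq0.
have -> : adic_child R n l k j.+1 =
  `[((k - 1)%:~R * n%:R + j%:R) / n%:R ^ (l + 1),
    ((k - 1)%:~R * n%:R + j%:R + 1) / n%:R ^ (l + 1)[%classic.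
  rewrite /adic_child expfzDr// expr1z -[j.+1]addn1 natrD.
  have E (x y : R) : x / n%:R ^ l + y / (n%:R ^ l * n%:R) =
      (x * n%:R + y) / (n%:R ^ l * n%:R).
    by field; rewrite n0 nl0.
  by rewrite !E addrK addrA.
by move: (k - 1) => k'; rewrite /cell !rmorphD /= !rmorphM/= -!pmulrn.
Qed.

Lemma cell_pow (R : realType) n (a : nat) (l k : int) :
  cell R (n ^ a) l k = cell R n (a%:Z * l) k.
Proof. by rewrite /cell natrX exprnP exprz_exp. Qed.

Lemma cell_sub (R : realType) n (l k : int) (s j : nat) : (0 < n)%N ->
  (j < n ^ s)%N ->
  cell R n (l + s%:Z) (k * (n ^ s)%N%:Z + j%:Z) `<=` cell R n l k.
Proof.
move=> n_gt0 js; have n0 : n%:R != 0 :> R by rewrite pnatr_eq0 -lt0n.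
have nl0 : 0 < n%:R ^ l :> R by rewrite exprz_gt0// ltr0n.
have ns0 : 0 < (n ^ s)%:R :> R by rewrite ltr0n expn_gt0 n_gt0.
have E (x : int) : x%:~R / n%:R ^ l =
    (x * (n ^ s)%N%:Z)%:~R / n%:R ^ (l + s%:Z) :> R.
  rewrite expfzDr// -exprnP -natrX rmorphM/= -pmulrn.
  by field; rewrite !gt_eqF.
have nls : 0 < n%:R ^ (l + s%:Z) :> R by rewrite exprz_gt0// ltr0n.
rewrite /cell !E; apply: subset_itv; rewrite leBSide/=.
  by rewrite ler_pM2r ?invr_gt0// ler_int; lia.
by rewrite ler_pM2r ?invr_gt0// ler_int; lia.
Qed.

(** With [l = a * q + r] and [r < a], level [l + 1] of base [n] lies between levels [q] and [q + 1]
    of base [n ^ a]. Two siblings [i] and [j] thus share an [n ^ a]-adic ancestor, one of whose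
    children fits inside sibling [j]. *)
Lemma cell_sandwich (R : realType) n (a : nat) (l k : int) (i j : nat) :
  (0 < n)%N -> (0 < a)%N -> (i < n)%N -> (j < n)%N ->
  exists q k' : int, exists t : nat, [/\ (t < n ^ a)%N,
    cell R n (l + 1) (k * n%:Z + i%:Z) `<=` cell R (n ^ a) q k' &
    cell R (n ^ a) (q + 1) (k' * (n ^ a)%N%:Z + t%:Z) `<=`
      cell R n (l + 1) (k * n%:Z + j%:Z)].
Proof.
move=> n_gt0 a_gt0 i_n j_n.
have n_neq0 (s : nat) : (n ^ s)%N%:Z != 0 by rewrite -lt0n expn_gt0 n_gt0.
have a_neq0 : a%:Z != 0 by rewrite -lt0n.
pose q := (l %/ a%:Z)%Z.
have [r lE r_a] : exists2 r : nat, l = a%:Z * q + r%:Z & (r < a)%N.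
  have r0 := modz_ge0 l a_neq0; exists `|(l %% a%:Z)%Z|%N.
    by rewrite gez0_abs// mulrC -divz_eq.
  by rewrite -ltz_nat gez0_abs// ltz_pmod.
pose k' := (k %/ (n ^ r)%N%:Z)%Z.
have [p kE p_n] : exists2 p : nat, k = k' * (n ^ r)%N%:Z + p%:Z & (p < n ^ r)%N.
  have p0 := modz_ge0 k (n_neq0 r); exists `|(k %% (n ^ r)%N%:Z)%Z|%N.
    by rewrite gez0_abs// -divz_eq.
  by rewrite -ltz_nat gez0_abs// ltz_pmod// ltz_nat expn_gt0 n_gt0.
have aE : a = (r + 1 + (a - r.+1))%N by lia.
set s := (a - r.+1)%N in aE.
(* Since [a = r + 1 + s], this index picks the leftmost descendant of sibling [j], [s] generations
   further down. *)
exists q, k', ((p * n + j) * n ^ s)%N; split.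
- rewrite aE !expnD expn1 ltn_pmul2r ?expn_gt0 ?n_gt0//.
  have : (p.+1 * n <= n ^ r * n)%N by rewrite leq_mul2r p_n orbT.
  by apply: leq_trans; rewrite mulSn addnC ltn_add2r.
- rewrite cell_pow; apply: (@subset_trans _ (cell R n l k)).
    by have := @cell_sub R n l k 1 i n_gt0; rewrite expn1; exact.
  by rewrite {1}lE kE; exact: cell_sub.
rewrite cell_pow.
have -> : a%:Z * (q + 1) = (l + 1) + s%:Z.
  have aZ : a%:Z = r%:Z + 1 + s%:Z by rewrite {1}aE.
  by rewrite lE mulrDr mulr1 {2}aZ; ring.
have -> : k' * (n ^ a)%N%:Z + ((p * n + j) * n ^ s)%N%:Z =
    (k * n%:Z + j%:Z) * (n ^ s)%N%:Z + 0%:Z.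
  by rewrite kE {1}aE !expnD expn1 !(PoszM, PoszD); ring.
by apply: cell_sub; rewrite // expn_gt0 n_gt0.
Qed.

(** * Doubling measures and powers of the base *)

Section doubling.
Context {R : realType}.
Implicit Type mu : {measure set (measurableTypeR R) -> \bar R}.

Lemma measurable_cell n l k : measurable (cell R n l k : set (measurableTypeR R)).
Proof. exact: measurable_itv. Qed.

Lemma le_cell mu n l k (A : set R) :
  measurable (A : set (measurableTypeR R)) -> A `<=` cell R n l k ->
  (mu A <= mu (cell R n l k))%E.
Proof.
by move=> mA sA; apply: le_measure; rewrite ?inE//; exact: measurable_cell.
Qed.

(** Multiplied out, the condition needs neither [fine] nor division. One inequality suffices because
    [i] and [j] can be exchanged. *)
Lemma adic_doublingP mu n : (0 < n)%N -> adic_doubling R n mu <->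
  (forall l k, 0 < mu (cell R n l k) < +oo)%E /\
  exists2 K : R, 0 < K & forall (l k : int) (i j : nat), (i < n)%N -> (j < n)%N ->
    (mu (cell R n (l + 1) (k * n%:Z + i%:Z)) <=
      K%:E * mu (cell R n (l + 1) (k * n%:Z + j%:Z)))%E.
Proof.
move=> n_gt0; split.
  move=> [fmu [C [C0 HC]]].
  have fc l k : (0 < mu (cell R n l k) < +oo)%E.
    by rewrite -[k](addrK 1) -adic_intervalE.
  split=> //; exists C => // l k i j i_n j_n.
  have := HC l (k + 1) i.+1 j.+1 i_n j_n.
  rewrite !adic_childE// addrK => /andP[_].
  have /andP[] := fc (l + 1) (k * n%:Z + i%:Z).
  have /andP[] := fc (l + 1) (k * n%:Z + j%:Z).
  case: (mu _) => [y| |]//= y0 _; case: (mu _) => [x| |]//= x0 _.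
  by rewrite -EFinM lee_fin ler_pdivrMr.
move=> [fc [K K0 HK]]; split.
  by move=> l k; rewrite adic_intervalE.
exists K; split => // l k [//|i] [//|j] /= i_n j_n.
rewrite !adic_childE//.
have := HK l (k - 1) i j i_n j_n; have := HK l (k - 1) j i j_n i_n.
have /andP[] := fc (l + 1) ((k - 1) * n%:Z + i%:Z).
have /andP[] := fc (l + 1) ((k - 1) * n%:Z + j%:Z).
case: (mu _) => [y| |]//= y0 _; case: (mu _) => [x| |]//= x0 _.
rewrite -!EFinM !lee_fin !lte_fin in x0 y0 *.
by move=> yx xy; rewrite ler_pdivrMr// xy ler_pdivlMr// ler_pdivrMl// yx.
Qed.

(** Finite subadditivity over the [n] children, by induction on the union of the first [i] of
    them. *)
Lemma measure_cell_le mu n (l k : int) (B : \bar R) : (0 < n)%N ->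
  (forall i, (i < n)%N -> (mu (cell R n (l + 1) (k * n%:Z + i%:Z)) <= B)%E) ->
  (mu (cell R n l k) <= n%:R%:E * B)%E.
Proof.
move=> n_gt0 HB; have n0 : n%:R != 0 :> R by rewrite pnatr_eq0 -lt0n.
have nl0 : 0 < n%:R ^ l :> R by rewrite exprz_gt0// ltr0n.
have nls : 0 < n%:R ^ (l + 1) :> R by rewrite exprz_gt0// ltr0n.
pose p (i : nat) : R := (k * n%:Z + i%:Z)%:~R / n%:R ^ (l + 1).
have B0 : (0 <= B)%E by apply: le_trans (HB 0 n_gt0); exact: measure_ge0.
have H i : (i <= n)%N -> (mu `[p 0%N, p i[%classic <= i%:R%:E * B)%E.
  elim: i => [_|i IH i_n]; first by rewrite set_itvco0 measure0 mul0e.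
  have -> : `[p 0%N, p i.+1[%classic = `[p 0%N, p i[ `|` `[p i, p i.+1[.
    apply: itv_bndbnd_setU; rewrite leBSide/=;
      by rewrite ler_pM2r ?invr_gt0// ler_int; lia.
  apply: le_trans; first by apply: measureU2; exact: measurable_itv.
  rewrite -natr1 EFinD ge0_muleDl ?lee_fin// mul1e leeD//; first exact/IH/ltnW.
  have -> : `[p i, p i.+1[%classic = cell R n (l + 1) (k * n%:Z + i%:Z).
    by rewrite /cell /p -addn1 PoszD addrA.
  exact: HB.
have -> : cell R n l k = `[p 0%N, p n[%classic.
  have E (x : int) : x%:~R / n%:R ^ l = (x * n%:Z)%:~R / n%:R ^ (l + 1) :> R.
    by rewrite expfzDr// rmorphM /= -pmulrn; field; rewrite n0 gt_eqF.
  by rewrite /cell /p !E addr0 mulrDl mul1r.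
exact: H.
Qed.

(** The bound against one fixed child holds for each of the [n] siblings; summing gives the constant
    [n * K]. *)
Lemma doubling_child mu n : (0 < n)%N -> adic_doubling R n mu ->
  exists2 K : R, 0 < K & forall (l k : int) (j : nat), (j < n)%N ->
    (mu (cell R n l k) <= K%:E * mu (cell R n (l + 1) (k * n%:Z + j%:Z)))%E.
Proof.
move=> n_gt0 /adic_doublingP[]// _ [K K0 HK].
exists (n%:R * K); first by rewrite mulr_gt0 ?ltr0n.
move=> l k j j_n; rewrite EFinM -muleA; apply: measure_cell_le => // i i_n.
exact: HK.
Qed.

(** Induction on the generation: descendant [j] is child [j %% n] of descendant [j %/ n]. *)
Lemma doubling_descendant mu n : (0 < n)%N -> adic_doubling R n mu ->
  forall s : nat,
  exists2 K : R, 0 < K & forall (l k : int) (j : nat), (j < n ^ s)%N ->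
    (mu (cell R n l k) <=
      K%:E * mu (cell R n (l + s%:Z) (k * (n ^ s)%N%:Z + j%:Z)))%E.
Proof.
move=> n_gt0 /doubling_child[]// K K0 HK; elim=> [|s [K' K'0 IH]].
  exists 1 => // l k [|//] _.
  by rewrite expn0 !addr0 mulr1 mul1e.
exists (K' * K); first exact: mulr_gt0.
move=> l k j js.
have jns : (j %/ n < n ^ s)%N by rewrite ltn_divLR// -expnSr.
apply: (le_trans (IH l k _ jns)); rewrite EFinM -muleA.
rewrite lee_pmul2l ?lte_fin//.
apply: (le_trans (HK _ _ (j %% n)%N _)); first by rewrite ltn_mod.
rewrite le_eqVlt; apply/orP; left; apply/eqP; congr (_ * mu (cell _ _ _ _))%E.
  by rewrite -addn1 PoszD addrA.
rewrite expnSr {3}(divn_eq j n) PoszD !PoszM; ring.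
Qed.

(** From [n ^ a] to [n], the sandwich bounds one sibling by an [n ^ a]-adic interval, and that by a
    child inside the other sibling. Conversely, [n ^ a]-adic children are [n]-adic descendants of
    generation [a]. *)
Lemma adic_doubling_expn n (a : nat) : (0 < n)%N -> (0 < a)%N ->
  adic_doubling R (n ^ a) = adic_doubling R n.
Proof.
move=> n_gt0 a_gt0; have N_gt0 : (0 < n ^ a)%N by rewrite expn_gt0 n_gt0.
apply/seteqP; split => mu dmu.
  have [K K0 HK] := doubling_child _ _ N_gt0 dmu.
  have [fc _] := (adic_doublingP _ _ N_gt0).1 dmu.
  apply/adic_doublingP => //; split.
    move=> l k; have n_neq0 : n%:Z != 0 by rewrite -lt0n.
    have [i kE i_n] : exists2 i : nat,
        k = (k %/ n%:Z)%Z * n%:Z + i%:Z & (i < n)%N.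
      have i0 := modz_ge0 k n_neq0; exists `|(k %% n%:Z)%Z|%N.
        by rewrite gez0_abs// -divz_eq.
      by rewrite -ltz_nat gez0_abs// ltz_pmod.
    (* With [i = j] the sandwich encloses a single cell: the inner interval gives positive mass, the
       outer one finite mass. *)
    have [q [k' [t [_ sub1 sub2]]]] :=
      cell_sandwich R n a (l - 1) (k %/ n%:Z)%Z i i n_gt0 a_gt0 i_n i_n.
    rewrite subrK -kE in sub1 sub2; apply/andP; split.
      have /andP[+ _] := fc (q + 1) (k' * (n ^ a)%N%:Z + t%:Z).
      by move=> /lt_le_trans; apply; apply: le_cell sub2; exact: measurable_cell.
    have /andP[_] := fc q k'.
    by apply: le_lt_trans; apply: le_cell sub1; exact: measurable_cell.
  exists K => // l k i j i_n j_n.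
  have [q [k' [t [tN sub1 sub2]]]] :=
    cell_sandwich R n a l k i j n_gt0 a_gt0 i_n j_n.
  apply: (@le_trans _ _ (mu (cell R (n ^ a) q k'))).
    by apply: le_cell sub1; exact: measurable_cell.
  apply: (le_trans (HK _ _ _ tN)); rewrite lee_pmul2l ?lte_fin//.
  by apply: le_cell sub2; exact: measurable_cell.
have [K K0 HK] := doubling_descendant _ _ n_gt0 dmu a.
have [fc _] := (adic_doublingP _ _ n_gt0).1 dmu.
apply/adic_doublingP => //; split; first by move=> l k; rewrite cell_pow.
exists K => // l k i j i_n j_n; rewrite !cell_pow mulrDr mulr1.
apply: le_trans (HK _ _ _ j_n).
by apply: le_cell; [exact: measurable_cell|exact: cell_sub].
Qed.
End doubling.

(** * Stieltjes measure of a nondecreasing Lipschitz function *)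

Section lipschitz.
Context {R : realType} (f : R -> R) (K : R).
Context (f_nd : {homo f : x y / x <= y}).
Context (f_lip : forall x y, x <= y -> f y - f x <= K * (y - x)).

Let f_rc : right_continuous f.
Proof.
apply: right_continuousW => x; apply/(@cvgrPdist_le _ R^o) => e e0; near=> y.
(* The denominator [|K| + 1] stays positive whatever the sign of [K]. *)
have H u v : u <= v -> v - u <= e / (`|K| + 1) -> `|f u - f v| <= e.
  move=> uv uve; have K1 : 0 < `|K| + 1 by rewrite ltr_wpDl.
  rewrite distrC ger0_norm ?subr_ge0 ?f_nd//.
  apply: (le_trans (f_lip _ _ uv)); move: uve; rewrite ler_pdivlMr// => uve.
  apply: le_trans uve; rewrite mulrC ler_wpM2l ?subr_ge0//.
  by rewrite (le_trans (ler_norm _))// lerDl.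
have yx : `|x - y| <= e / (`|K| + 1).
  near: y; apply: (@cvgr_dist_le _ R^o); [exact: cvg_id|].
  by rewrite divr_gt0// ltr_wpDl.
have [xy|/ltW xy] := leP x y.
  by apply: H => //; apply: le_trans yx; rewrite distrC ler_norm.
by rewrite distrC; apply: H => //; apply: le_trans yx; rewrite ler_norm.
Unshelve. all: by end_near. Qed.

HB.instance Definition _ := isCumulative.Build R _ R f f_nd f_rc.

Lemma lebesgue_stieltjes_oc a b : a <= b ->
  lebesgue_stieltjes_measure f `]a, b]%classic = (f b - f a)%:E.
Proof.
move=> ab; rewrite /lebesgue_stieltjes_measure /measure_extension.
rewrite measurable_mu_extE/=; last exact: is_ocitv.
by rewrite wlength_itv_bnd.
Qed.

Lemma lebesgue_stieltjes_co a b : a <= b ->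
  lebesgue_stieltjes_measure f `[a, b[%classic = (f b - f a)%:E.
Proof.
(* [a, b[ is squeezed between ]a, b - e] and ]a - e, b]. *)
move=> ab; have bnd e : 0 < e ->
   (((f b - f a)%:E - (`|K| * e)%:E <=
      lebesgue_stieltjes_measure f `[a, b[%classic) /\
    (lebesgue_stieltjes_measure f `[a, b[%classic <=
      (f b - f a)%:E + (`|K| * e)%:E))%E.
  move=> e0; have Ke x : f x - f (x - e) <= `|K| * e.
    apply: (le_trans (f_lip _ _ _)); first by rewrite gerBl ltW.
    by rewrite subKr ler_wpM2r ?ler_norm// ltW.
  split.
    have [abe|bae] := leP a (b - e).
      rewrite -EFinB.
      apply: (@le_trans _ _ (lebesgue_stieltjes_measure f `]a, b - e]%classic)).
        rewrite lebesgue_stieltjes_oc// lee_fin; have := Ke b; lra.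
      apply: le_measure; rewrite ?inE;
        [exact: measurable_itv|exact: measurable_itv|].
      by apply: subset_itv; rewrite !leBSide/= ?ltrBlDr ?ltrDl.
    (* Here [b - e < a], so the inner interval is empty, but the lower bound is then at most 0. *)
    apply: (@le_trans _ _ 0%E); last exact: measure_ge0.
    rewrite -EFinB lee_fin; have := Ke b; have := f_nd _ _ (ltW bae); lra.
  apply: (@le_trans _ _ (lebesgue_stieltjes_measure f `]a - e, b]%classic)).
    apply: le_measure; rewrite ?inE;
        [exact: measurable_itv|exact: measurable_itv|].
    by apply: subset_itv; rewrite !leBSide/= ?ltrBlDr ?ltrDl.
  rewrite lebesgue_stieltjes_oc; last by lra.
  rewrite -EFinD lee_fin; have := Ke a; lra.
apply/eqP; rewrite eq_le; apply/andP; split.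
  apply/lee_addgt0Pr => e e0.
  have K1 : 0 < `|K| + 1 by rewrite ltr_wpDl.
  apply: (le_trans (bnd (e / (`|K| + 1)) _).2); first by rewrite divr_gt0.
  rewrite leeD2l// lee_fin mulrCA ler_piMr ?(ltW e0)// ler_pdivrMr//; lra.
apply/lee_subgt0Pr => e e0.
have K1 : 0 < `|K| + 1 by rewrite ltr_wpDl.
apply: le_trans (bnd (e / (`|K| + 1)) _).1; last by rewrite divr_gt0.
rewrite leeB// lee_fin mulrCA ler_piMr ?(ltW e0)// ler_pdivrMr//; lra.
Qed.

Lemma lipschitz_measure :
  exists mu : {measure set (measurableTypeR R) -> \bar R},
    forall a b, a <= b -> mu `[a, b[%classic = (f b - f a)%:E.
Proof.
exists (lebesgue_stieltjes_measure f); exact: lebesgue_stieltjes_co.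
Qed.
End lipschitz.

(** * Multiplicative dependence and cofactors of powers *)

Lemma rational_ln_ratio (R : realType) (n m : nat) : (1 < n)%N -> (1 < m)%N ->
  rational (ln n%:R / ln m%:R : R) <->
  exists a b : nat, [/\ (0 < a)%N, (0 < b)%N & (n ^ a = m ^ b)%N].
Proof.
move=> n_gt1 m_gt1.
have n0 : 0 < n%:R :> R by rewrite ltr0n ltnW.
have m0 : 0 < m%:R :> R by rewrite ltr0n ltnW.
have ln_n : 0 < ln n%:R :> R by rewrite ln_gt0// ltr1n.
have ln_m : 0 < ln m%:R :> R by rewrite ln_gt0// ltr1n.
split=> [/rationalP[p [a pa]]|[a [b [a0 b0 ab]]]].
  (* Positivity of the ratio rules out both [p <= 0] and [a = 0], where the quotient would be 0 by
     convention. *)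
  have pa0 : 0 < p%:~R / a%:R :> R by rewrite -pa divr_gt0.
  have a0 : (0 < a)%N by case: a {pa} pa0 => //; rewrite invr0 mulr0 ltxx.
  have p0 : 0 < p.
    by rewrite -(ltr0z R); move: pa0; rewrite pmulr_lgt0// invr_gt0 ltr0n.
  case: p p0 pa pa0 => // b b0 pa _; exists a, b; split => //.
  have a0R : a%:R != 0 :> R by rewrite pnatr_eq0 -lt0n.
  have : ln (n%:R ^+ a) = ln (m%:R ^+ b) :> R.
    rewrite !lnXn// -[LHS]mulr_natr -[RHS]mulr_natl; apply/eqP.
    by rewrite -eqr_div ?(gt_eqF ln_m)// pa.
  move/ln_inj; rewrite !posrE !exprn_gt0// => /(_ isT isT).
  by rewrite -!natrX => /eqP; rewrite eqr_nat => /eqP.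
apply/rationalP; exists b%:Z, a.
have a0R : a%:R != 0 :> R by rewrite pnatr_eq0 -lt0n.
have : ln (n%:R ^+ a) = ln (m%:R ^+ b) :> R by rewrite -!natrX ab.
rewrite !lnXn// -[LHS]mulr_natr -[RHS]mulr_natl => E.
by apply/eqP; rewrite eqr_div ?(gt_eqF ln_m)// E.
Qed.

(** Divide by [m] as long as possible. As [m] may be composite, [q] can still share factors with
    [m]. *)
Lemma expn_factor (m x : nat) : (1 < m)%N -> (0 < x)%N ->
  exists j q : nat, x = (m ^ j * q)%N /\ ~~ (m %| q)%N.
Proof.
move=> m_gt1; elim/ltn_ind: x => x IH x0.
have [/dvdnP[y xE]|mx] := boolP (m %| x)%N; last by exists 0%N, x; rewrite mul1n.
have y0 : (0 < y)%N by rewrite xE muln_gt0 in x0; case/andP: x0.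
have [|j [q [yE mq]]] := IH y _ y0.
  by rewrite xE -[X in (X < _)%N]muln1 ltn_mul2l y0.
by exists j.+1, q; split=> //; rewrite xE yE expnS mulnC mulnA.
Qed.

(** Pigeonhole: if all cofactors were at most [C], two of the [C + 2] powers
    [n ^ 0, ..., n ^ (C + 1)] would share one, and their quotient would be both a power of [n] and a
    power of [m]. *)
Lemma cofactor_unbounded (n m : nat) : (1 < n)%N -> (1 < m)%N ->
  ~ (exists a b : nat, [/\ (0 < a)%N, (0 < b)%N & (n ^ a = m ^ b)%N]) ->
  forall C : nat, exists l j q : nat,
    [/\ (n ^ l = m ^ j * q)%N, ~~ (m %| q)%N & (C < q)%N].
Proof.
move=> n_gt1 m_gt1 nm C; apply: contrapT => H.
have [|g gP] := @choice nat nat (fun l q =>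
    (q < C.+1)%N /\ exists j, (n ^ l = m ^ j * q)%N).
  move=> l; have [|j [q [nE mq]]] := expn_factor m (n ^ l) m_gt1.
    by rewrite expn_gt0 ltnW.
  exists q; split; last by exists j.
  by rewrite ltnS leqNgt; apply/negP => Cq; apply: H; exists l, j, q.
pose f (l : 'I_C.+2) : 'I_C.+1 := inord (g l).
have : ~ injective f by move=> /leq_card; rewrite !card_ord ltnn.
apply => l l' ff; apply/eqP/negPn/negP => ll'; apply: nm.
have [gl [j jE]] := gP l; have [gl' [j' jE']] := gP l'.
have {}ff : g l = g l' by have := congr1 val ff; rewrite /= !inordK.
have q0 : (0 < g l)%N.
  by rewrite lt0n; apply/eqP => q0; move: jE;
    rewrite q0 muln0 => /eqP; rewrite expn_eq0; lia.
rewrite -ff in jE'; move: (g l) q0 jE jE' {gl gl' ff} => q q0.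
wlog : l l' j j' ll' / (l < l')%N.
  move=> W jE jE'; have [h|h|/val_inj h] := ltngtP l l'.
  - exact: (W l l' j j').
  - by apply: (W l' l j' j) => //; rewrite eq_sym.
  - by rewrite h eqxx in ll'.
move=> lt_l jE jE'; exists (l' - l)%N, (j' - j)%N.
have lt_j : (j < j')%N.
  by rewrite -(ltn_exp2l _ _ m_gt1) -(ltn_pmul2r q0) -jE -jE' ltn_exp2l.
rewrite !subn_gt0; split => //.
apply/eqP; rewrite -(eqn_pmul2l (_ : 0 < n ^ l)%N) ?expn_gt0 ?(ltnW n_gt1)//.
by rewrite -expnD (subnKC (ltnW lt_l)) jE' jE mulnAC -expnD (subnKC (ltnW lt_j)).
Qed.

(** * The piecewise quadratic distribution function *)

Section warp.
Context {R : realType}.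

(* The intervals [n^L, 2 n^L] are disjoint for n > 2, so L is unique. *)
Definition warp (n : nat) (x : R) : R :=
  if pselect (exists L : nat, n%:R ^+ L <= x <= 2 * n%:R ^+ L) is left h
  then let a := n%:R ^+ projT1 (cid h) in a + (x - a) ^+ 2 / a
  else x.

Context (n : nat) (n_gt2 : (2 < n)%N).

Lemma expr_natr_gap (L L' : nat) : (L < L')%N -> 2 * n%:R ^+ L < n%:R ^+ L' :> R.
Proof.
move=> LL'; have n2 : 2 < n%:R :> R by rewrite ltr_nat.
apply: (@lt_le_trans _ _ (n%:R ^+ L.+1)).
  by rewrite exprS ltr_pM2r// exprn_gt0//; lra.
by rewrite ler_weXn2l//; lra.
Qed.

Lemma expr_natr_uniq (L L' : nat) (x : R) : n%:R ^+ L <= x <= 2 * n%:R ^+ L ->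
  n%:R ^+ L' <= x <= 2 * n%:R ^+ L' -> L = L'.
Proof.
move=> /andP[h1 h2] /andP[h3 h4].
have [LL'|LL'|//] := ltngtP L L'.
  by have := lt_le_trans (expr_natr_gap _ _ LL') (le_trans h3 h2); rewrite ltxx.
by have := lt_le_trans (expr_natr_gap _ _ LL') (le_trans h1 h4); rewrite ltxx.
Qed.

Lemma warp_in (L : nat) (x : R) : n%:R ^+ L <= x <= 2 * n%:R ^+ L ->
  warp n x = n%:R ^+ L + (x - n%:R ^+ L) ^+ 2 / n%:R ^+ L.
Proof.
move=> xL; rewrite /warp; case: pselect => [h|]; last by case; exists L.
by case: cid => L' /= xL'; rewrite (expr_natr_uniq _ _ _ xL xL').
Qed.

Lemma expr_natr_gt0 (L : nat) : 0 < n%:R ^+ L :> R.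
Proof. by rewrite exprn_gt0// ltr0n; lia. Qed.

(** The hypothesis allows the endpoints of the special intervals; the quadratic formula fixes
    both. *)
Lemma warp_out (x : R) : (forall L : nat, ~~ (n%:R ^+ L < x < 2 * n%:R ^+ L)) ->
  warp n x = x.
Proof.
move=> nx; rewrite /warp; case: pselect => // h; case: cid => L /= /andP[h1 h2].
have a0 := expr_natr_gt0 L.
move: h1 (nx L); rewrite le_eqVlt => /orP[/eqP <- _|->/=].
  by rewrite subrr expr0n/= mul0r addr0.
rewrite -leNgt => h3; have -> : x = 2 * n%:R ^+ L by lra.
by field; rewrite gt_eqF.
Qed.

(** In the rescaled coordinate [u] the map sends [1 + u] to [1 + u ^+ 2]. Endpoints are fixed and
    belong to [WarpOut]. *)
Variant warp_spec (x : R) : R -> Type :=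
| WarpIn (L : nat) (u : R) of 0 < u < 1 & x = n%:R ^+ L * (1 + u) :
    warp_spec x (n%:R ^+ L * (1 + u ^+ 2))
| WarpOut of (forall L : nat, x <= n%:R ^+ L \/ 2 * n%:R ^+ L <= x) : warp_spec x x.

Lemma warpP (x : R) : warp_spec x (warp n x).
Proof.
have [/cid[L]|nx] := pselect (exists L : nat, n%:R ^+ L < x < 2 * n%:R ^+ L).
  move=> /andP[h1 h2]; rewrite (warp_in L) ?ltW//; have a0 := expr_natr_gt0 L.
  set a := n%:R ^+ L in h1 h2 a0 *.
  have -> : a + (x - a) ^+ 2 / a = a * (1 + ((x - a) / a) ^+ 2).
    by field; rewrite gt_eqF.
  apply: (@WarpIn x L ((x - a) / a)); last by rewrite -/a; field; rewrite gt_eqF.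
  by rewrite divr_gt0 ?subr_gt0// ltr_pdivrMr//; lra.
have nx' L : ~~ (n%:R ^+ L < x < 2 * n%:R ^+ L).
  by apply/negP => h; apply: nx; exists L.
rewrite warp_out//; apply: WarpOut => L.
by have := nx' L; rewrite negb_and -!leNgt => /orP[]; [left|right].
Qed.

Lemma warp_le (x : R) : warp n x <= x.
Proof.
case: warpP => // L u /andP[u0 u1] ->; have := expr_natr_gt0 L => a0.
by rewrite ler_pM2l//; nra.
Qed.

(** On a special interval the slope is [2 * u] with [0 < u < 1], elsewhere it is 1; the cases
    compare points on different pieces. *)
Lemma warp_lip (x y : R) : x < y -> 0 < warp n y - warp n x <= 2 * (y - x).
Proof.
case: (warpP x) => [L u /andP[u0 u1] ->|hx];
  case: (warpP y) => [L' v /andP[v0 v1] ->|hy].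
- have a0 := expr_natr_gt0 L; have b0 := expr_natr_gt0 L'.
  have [LL'|LL'|<-] := ltngtP L L'.
  + have := expr_natr_gap _ _ LL'; move: a0 b0.
    set a := n%:R ^+ L; set b := n%:R ^+ L' => a0 b0 ab _.
    (* The increment is [(b - 2 * a) + a * (1 - u ^+ 2) + b * v ^+ 2], and the slack in the upper
       bound is [(b - 2 * a) + a * (1 - u) ^+ 2 + b * (v * (2 - v))]. *)
    have ? : 0 < a * (1 - u ^+ 2) by rewrite mulr_gt0//; nra.
    have ? : 0 <= a * (1 - u) ^+ 2 by rewrite mulr_ge0 ?sqr_ge0// ltW.
    have ? : 0 <= b * v ^+ 2 by rewrite mulr_ge0 ?sqr_ge0// ltW.
    have ? : 0 <= b * (v * (2 - v)) by rewrite ?mulr_ge0 ?ltW//; lra.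
    apply/andP; split; nra.
  + have := expr_natr_gap _ _ LL'; move: a0 b0.
    set a := n%:R ^+ L; set b := n%:R ^+ L' => a0 b0 ab.
    move=> h; exfalso; nra.
  + rewrite ltr_pM2l// => uv; rewrite -!mulrBr mulrCA pmulr_rgt0// ler_pM2l//.
    apply/andP; split; nra.
- move=> xy; have a0 := expr_natr_gt0 L; move: (hy L) a0 xy; set a := n%:R ^+ L.
  move=> [h|h] a0 xy; apply/andP; split; nra.
- move=> xy; have a0 := expr_natr_gt0 L'; move: (hx L') a0 xy; set a := n%:R ^+ L'.
  move=> [h|h] a0 xy; apply/andP; split; nra.
- by move=> xy; apply/andP; split; lra.
Qed.
End warp.

(** * Doubling in base [n] and its failure in base [m] *)

Section warp_measure.
Context {R : realType} (n : nat) (n_gt2 : (2 < n)%N).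
Context (mu : {measure set (measurableTypeR R) -> \bar R}).
Context (muE : forall a b,
  a <= b -> mu `[a, b[%classic = (warp n b - warp n a)%:E).

(** The excluded case is that of a cell [l], [k] inside some [[n^L, 2 n^L]], where [s = l + L].
    Allowing [i = n] covers the right end of the last child. *)
Lemma warp_fixed (l k : int) (i : nat) : (i <= n)%N ->
  ~ (exists L s : nat, l = s%:Z - L%:Z /\ (n ^ s)%N%:Z <= k < 2 * (n ^ s)%N%:Z) ->
  warp n ((k * n%:Z + i%:Z)%:~R / n%:R ^ (l + 1)) =
    (k * n%:Z + i%:Z)%:~R / n%:R ^ (l + 1) :> R.
Proof.
move=> i_n nh; apply: warp_out => // L; apply/negP => /andP[h1 h2].
have n0 : n%:R != 0 :> R by rewrite pnatr_eq0; lia.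
have nl : 0 < n%:R ^ (l + 1) :> R by rewrite exprz_gt0// ltr0n; lia.
move: h1 h2; rewrite ltr_pdivlMr// ltr_pdivrMr// -mulrA.
(* If [l + L >= 0], the ends of [[n^L, 2 n^L]] are level-[l] grid points, so a child endpoint
   strictly between them puts the whole cell inside. *)
have [s0|s0] := leP 0 (l + L%:Z).
  have [s sE] : exists s : nat, l + L%:Z = s.
    by exists `|(l + L%:Z)%R|%N; rewrite gez0_abs.
  have -> : n%:R ^+ L * n%:R ^ (l + 1) = (n ^ s.+1)%N%:Z%:~R :> R.
    rewrite -pmulrn natrX !exprnP -expfzDr//; congr (_ ^ _); lia.
  rewrite -[2]/(2%:Z%:~R) -rmorphM/= !ltr_int expnS => h1 h2.
  apply: nh; exists L, s; split; first by rewrite -sE addrK.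
  move: (n ^ s)%N h1 h2 => N h1 h2.
  by apply/andP; split; nia.
(* Otherwise the grid of the children has mesh [n ^ (L + t)], and an integer multiple of [n ^ t]
   would lie strictly between 1 and 2. *)
have [t tE] : exists t : nat, - (l + 1 + L%:Z) = t.
  by exists `|(- (l + 1 + L%:Z))%R|%N; rewrite gez0_abs; lia.
have -> : n%:R ^+ L * n%:R ^ (l + 1) = ((n ^ t)%N%:Z%:~R)^-1 :> R.
  rewrite -pmulrn natrX !exprnP -expfzDr// invr_expz; congr (_ ^ _); lia.
have nt0 : 0 < (n ^ t)%N%:Z%:~R :> R by rewrite ltr0z ltz_nat expn_gt0; lia.
rewrite ltr_pdivlMr// -[_^-1]mul1r ltr_pdivrMr// -!rmorphM/=.
rewrite -[2]/(2%:Z%:~R) -[1]/(1%:Z%:~R) !ltr_int; lia.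
Qed.

(** With [w = k - n ^ s.+1], the offset in grid steps from [n^L], this is
    [(w + 1)^2 - w^2 = 2 w + 1] up to scale. *)
Lemma warp_quadratic (L s : nat) (k : int) :
  (n ^ s.+1)%N%:Z <= k < 2 * (n ^ s.+1)%N%:Z ->
  warp n ((k + 1)%:~R / n%:R ^ (s%:Z - L%:Z + 1)) -
    warp n (k%:~R / n%:R ^ (s%:Z - L%:Z + 1)) =
  n%:R ^+ L / (n ^ s.+1)%:R ^+ 2 * (2 * (k - (n ^ s.+1)%N%:Z) + 1)%:~R :> R.
Proof.
move=> /andP[k1 k2].
have n0 : n%:R != 0 :> R by rewrite pnatr_eq0; lia.
have N0 : 0 < (n ^ s.+1)%:R :> R by rewrite ltr0n expn_gt0; lia.
have L0 := expr_natr_gt0 n n_gt2 L : 0 < _ :> R.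
have E (x : int) : x%:~R / n%:R ^ (s%:Z - L%:Z + 1) =
    n%:R ^+ L * (x%:~R / (n ^ s.+1)%:R) :> R.
  have -> : s%:Z - L%:Z + 1 = s.+1%:Z - L%:Z by rewrite -addn1 PoszD; ring.
  rewrite expfzDr// -exprnP -exprnN -[n%:R ^+ s.+1]natrX.
  by field; rewrite !gt_eqF.
have Q (x : int) : (n ^ s.+1)%N%:Z <= x <= 2 * (n ^ s.+1)%N%:Z ->
    warp n (n%:R ^+ L * (x%:~R / (n ^ s.+1)%:R)) =
    n%:R ^+ L * (1 + (x%:~R / (n ^ s.+1)%:R - 1) ^+ 2) :> R.
  rewrite -(ler_int R) -(ler_int R x) rmorphM/= -pmulrn => /andP[x1 x2].
  rewrite (warp_in _ n_gt2 L).
    by field; rewrite !gt_eqF.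
  by rewrite ler_pMr// ler_pdivlMr// mul1r x1 [2 * _]mulrC ler_pM2l// ler_pdivrMr.
rewrite !E !Q; try lia.
rewrite !rmorphD/= !rmorphM/= rmorphB/= -pmulrn.
by field; rewrite !gt_eqF.
Qed.

Lemma warp_doubling : adic_doubling R n mu.
Proof.
have n_gt0 : (0 < n)%N by lia.
have nl l : 0 < n%:R ^ l :> R by rewrite exprz_gt0// ltr0n.
have lt_end l k : k%:~R / n%:R ^ l < (k + 1)%:~R / n%:R ^ l :> R.
  by rewrite ltr_pM2r ?invr_gt0// ltr_int; lia.
have cellE l k : mu (cell R n l k) =
    (warp n ((k + 1)%:~R / n%:R ^ l) - warp n (k%:~R / n%:R ^ l))%:E.
  by rewrite muE// ltW.
apply/adic_doublingP => //; split.
  move=> l k; rewrite cellE lte_fin ltry andbT.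
  by have /andP[] := warp_lip n n_gt2 _ _ (lt_end l k).
(* The worst case is the parent starting at [n^L]: its children have masses proportional to
   [1, 3, ..., 2 n - 1]. *)
exists (2 * n%:R); first by rewrite mulr_gt0// ltr0n.
move=> l k i j i_n j_n; rewrite !cellE -EFinM lee_fin.
have [[L [s [-> /andP[k1 k2]]]]|h] := pselect (exists L s : nat,
    l = s%:Z - L%:Z /\ (n ^ s)%N%:Z <= k < 2 * (n ^ s)%N%:Z).
  have L0 := expr_natr_gt0 n n_gt2 L : 0 < _ :> R.
  have N0 : 0 < (n ^ s.+1)%:R :> R by rewrite ltr0n expn_gt0 n_gt0.
  rewrite !warp_quadratic; last 2 first.
    by rewrite expnS; move: (n ^ s)%N k1 k2 => N k1 k2; nia.
    by rewrite expnS; move: (n ^ s)%N k1 k2 => N k1 k2; nia.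
  rewrite mulrCA ler_pM2l; last by rewrite divr_gt0// exprn_gt0.
  have -> : 2 * n%:R = (2 * n%:Z)%:~R :> R by rewrite rmorphM/= -pmulrn.
  rewrite -rmorphM/= ler_int expnS.
  move: (n ^ s)%N k1 {k2} => N k1.
  have w0 : 0 <= (k - N%:Z) * n%:Z by rewrite mulr_ge0// subr_ge0.
  have wE (t : nat) : k * n%:Z + t%:Z - (n * N)%N%:Z = (k - N%:Z) * n%:Z + t%:Z.
    by rewrite PoszM; ring.
  rewrite !wE; move: ((k - N%:Z) * n%:Z) w0 => w w0; nia.
(* All endpoints are fixed, so every child keeps its length as mass. *)
have flat (t : nat) : (t < n)%N ->
    warp n ((k * n%:Z + t%:Z + 1)%:~R / n%:R ^ (l + 1)) -
    warp n ((k * n%:Z + t%:Z)%:~R / n%:R ^ (l + 1)) = (n%:R ^ (l + 1))^-1 :> R.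
  move=> t_n; have -> : k * n%:Z + t%:Z + 1 = k * n%:Z + t.+1%:Z.
    by rewrite -addn1 PoszD addrA.
  rewrite !warp_fixed//; last exact: ltnW.
  rewrite -mulrBl -rmorphB/=.
  have -> : k * n%:Z + t.+1%:Z - (k * n%:Z + t%:Z) = 1 by lia.
  by rewrite mul1r.
rewrite !flat// ler_peMl// ?invr_ge0 ?ltW//.
by rewrite -natrM ltr1n; lia.
Qed.

Lemma warp_not_doubling (m : nat) : (1 < m)%N ->
  ~ (exists a b : nat, [/\ (0 < a)%N, (0 < b)%N & (n ^ a = m ^ b)%N]) ->
  ~ adic_doubling R m mu.
Proof.
move=> m_gt1 nm; have m_gt0 := ltnW m_gt1.
move=> /(adic_doublingP _ _ m_gt0)[_ [K K0 HK]].
have [l [j [q [nE mq qK]]]] :=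
  cofactor_unbounded n m (ltnW n_gt2) m_gt1 nm (Num.truncn K).
have {}qK : K < q%:R by apply: (lt_le_trans (truncnS_gt K)); rewrite ler_nat.
(* The cells of length [m ^ j] with indices [q - 1] and [q] meet at [m ^ j * q = n ^ l]. They have
   the same parent because [q %% m] is nonzero. *)
have {HK} := HK (- j.+1%:Z) (q %/ m)%N%:Z (q %% m).-1 (q %% m)%N.
have r_m : (q %% m < m)%N by rewrite ltn_mod.
have r0 : (0 < q %% m)%N by rewrite lt0n.
move=> /(_ _ r_m) H; have {H} := H (leq_ltn_trans (leq_pred _) r_m).
have -> : - j.+1%:Z + 1 = - j%:Z by rewrite -addn1 PoszD opprD addrNK.
have -> : (q %/ m)%N%:Z * m%:Z + (q %% m)%N%:Z = q.
  by rewrite -PoszM -PoszD -divn_eq.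
have -> : (q %/ m)%N%:Z * m%:Z + (q %% m).-1%:Z = q%:Z - 1.
  rewrite [in RHS](divn_eq q m) PoszD PoszM -addrA; congr (_ + _); lia.
have M0 : 0 < m%:R ^+ j :> R by rewrite exprn_gt0// ltr0n.
have q1 : (1 <= q)%N by apply: leq_trans r0 (leq_mod _ _).
have q0 : 1 <= q%:R :> R by rewrite ler1n.
have L0 := expr_natr_gt0 n n_gt2 l : 0 < _ :> R.
have nER : n%:R ^+ l = m%:R ^+ j * q%:R :> R by rewrite -!natrX nE natrM.
rewrite /cell subrK !muE; last 2 first.
- by rewrite ler_pM2r ?invr_gt0 ?exprz_gt0 ?ltr0n// ler_int; lia.
- by rewrite ler_pM2r ?invr_gt0 ?exprz_gt0 ?ltr0n// ler_int; lia.
rewrite -exprnN invrK -EFinM lee_fin -!pmulrn rmorphB/= rmorphD/= -pmulrn.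
(* Since [warp] fixes [n ^ l] and never exceeds the identity, the left mass is at least [m ^ j]; the
   right one is [m ^ j / q]. *)
have W := warp_le n n_gt2 ((q%:R - 1) * m%:R ^+ j : R).
have W1 : warp n (q%:R * m%:R ^+ j) = q%:R * m%:R ^+ j :> R.
  rewrite (warp_in _ n_gt2 l) nER [q%:R * _]mulrC.
    by rewrite subrr expr0n/= mul0r addr0.
  by rewrite lexx/= ler_peMl// ?ler1n// mulr_ge0 ?ltW//; lra.
have W2 : warp n ((q%:R + 1) * m%:R ^+ j) =
    q%:R * m%:R ^+ j + m%:R ^+ j / q%:R :> R.
  rewrite (warp_in _ n_gt2 l) nER.
    by field; rewrite !gt_eqF//; lra.
  move: (m%:R ^+ j) M0 => M M0; apply/andP; split; nra.
rewrite W1 W2 addrAC subrr add0r => H.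
have {H}W : m%:R ^+ j <= K * (m%:R ^+ j / q%:R) by lra.
have : q%:R <= K.
  move: W; rewrite mulrA ler_pdivlMr; last lra.
  by rewrite mulrC ler_pM2r.
by rewrite leNgt qK.
Qed.
End warp_measure.

Theorem theorem1p2 (R : realType) (n m : nat -> nat)
    (hn : forall i, (2 < n i)%N) (hm : forall j, (2 < m j)%N) :
  (exists i, forall j, @irrational R (ln (n i)%:R / ln (m j)%:R)) <->
  ~ (\bigcup_i adic_doubling R (n i) `<=` \bigcup_j adic_doubling R (m j)).
Proof.
split=> [[i irr] sub|].
  have n_gt2 := hn i.
  have warp_bnd (x y : R) : x <= y ->
      0 <= warp (n i) y - warp (n i) x <= 2 * (y - x).
    rewrite le_eqVlt => /predU1P[->|]; first by rewrite !subrr mulr0 lexx.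
    by move=> /(warp_lip _ n_gt2) /andP[/ltW -> ->].
  have warp_nd : {homo @warp R (n i) : x y / x <= y}.
    by move=> x y /warp_bnd /andP[+ _]; rewrite subr_ge0.
  (* This measure depends on [n i] alone, so it fails to be doubling for every [m j] at once. *)
  have [mu muE] := lipschitz_measure (warp (n i)) 2 warp_nd
    (fun x y xy => (andP (warp_bnd x y xy)).2).
  have [|j _] := sub mu; first by exists i => //; exact: warp_doubling.
  apply: (warp_not_doubling _ n_gt2 mu muE (m j)); first exact: ltnW (hm j).
  by move=> /(rational_ln_ratio R _ _ (ltnW n_gt2) (ltnW (hm j))); exact: irr.
(* Contrapositive: without such an [i], each [n i] has a common power with some [m j], and the two
   doubling classes coincide. *)
apply: contra_notP => ninc mu [i _ mu_i].
have [j rat_ij] : exists j, rational (ln (n i)%:R / ln (m j)%:R : R).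
  by apply: contrapT => nrat; apply: ninc; exists i => j rat_ij;
    apply: nrat; exists j.
have [a [b [a0 b0 ab]]] :=
  (rational_ln_ratio R _ _ (ltnW (hn i)) (ltnW (hm j))).1 rat_ij.
exists j => //.
rewrite -(adic_doubling_expn (m j) b)//; last exact: ltnW (ltnW (hm j)).
by rewrite -ab adic_doubling_expn//; exact: ltnW (ltnW (hn i)).
Qed.
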